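(* Let $L\in\mathcal{C}(\mathbb{R}^d)$ and $G\in\mathcal{C}(\mathbb{R}^d)$ satisfy: (W1) $\underline{L}:=\inf_{\theta\in\mathbb{R}^d}L(\theta)>-\infty$; (W2) there is $C_1>0$ with $|L(\theta)-L(\theta')|\le C_1\|\theta-\theta'\|_2$ for all $\theta,\theta'\in\mathbb{R}^d$; (W3) the function $q\in[0,\infty)\mapsto \mathrm{Vol}(\{\theta\in B_R(0):L(\theta)\le q\})$ is $C_L$-Lipschitz continuous; (W4) $\underline{G}:=\inf_{\theta\in\mathbb{R}^d}G(\theta)>-\infty$; (W5) either $\sup_{\theta\in\mathbb{R}^d}G(\theta)<\infty$, or there exist $C_2,C_3>0$ with $G(\theta)-\underline{G}\ge C_2\|\theta\|_2^2$ for all $\|\theta\|_2\ge C_3$; (W6) there is $C_4>0$ with $G(\theta)-\underline{G}\le C_4(1+\|\theta\|_2^2)$ for all $\theta\in\mathbb{R}^d$. Let $\varrho,\widetilde\varrho\in\mathcal{P}_2(\mathbb{R}^d)\cap L^\infty(B_R(0))$ with $\int_{\mathbb{R}^d}\|\theta\|_2^2\,\varrho\,d\theta\le K$ and $\int_{\mathbb{R}^d}\|\theta\|_2^2\,\widetilde\varrho\,d\theta\le K$, and such that $\varrho(Q^L_\beta[\varrho])\ge c$ and $\widetilde\varrho(Q^L_\beta[\widetilde\varrho])\ge c$, for constants $K<\infty$ and $c>0$. Then $$\big\|m^{G,L}_{\alpha,\beta}(\varrho)-m^{G,L}_{\alpha,\beta}(\widetilde\varrho)\big\|_2\le C\Big(\|\varrho-\widetilde\varrho\|_{L^2(B_R(0))}+W_2(\varrho,\widetilde\varrho)\Big),$$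 where the constant $C$ depends only on $R$, $K$, $c_K:=\frac1c\exp\big(\frac{\alpha}{c}C_4(1+K)\big)$ and the constant $\widetilde C$ described in the context.
   Context: Fixed parameters: $\alpha,\delta_q,R>0$ and $\beta\in(0,1]$. $\mathcal{P}(\mathbb{R}^d)$ is the set of Borel probability measures on $\mathbb{R}^d$, $\mathcal{P}_2(\mathbb{R}^d)$ those with finite second moment, $W_2$ the Wasserstein-2 distance, $B_R(0)$ the closed Euclidean ball. Measures are identified with their Lebesgue densities; $\varrho\in L^\infty(B_R(0))$ means the density is bounded on $B_R(0)$. For $\varrho\in\mathcal{P}(\mathbb{R}^d)$ and $a\in(0,1]$, define $q^L_a[\varrho]:=\inf\{q: a\le\varrho(\{\theta:L(\theta)\le q\})\}$, $$Q^L_\beta[\varrho]:=\Big\{\theta\in B_R(0):L(\theta)\le\frac{2}{\beta}\int_{\beta/2}^{\beta}q^L_a[\varrho]\,da+\delta_q\Big\},\qquad I^L_\beta[\varrho]:=\mathbb{1}_{Q^L_\beta[\varrho]}\,\varrho,\qquad \omega^G_\alpha(\theta):=\exp(-\alpha G(\theta)),$$ $$m^{G,L}_{\alpha,\beta}(\varrho):=\int\theta\,\frac{\omega^G_\alpha(\theta)}{\|\omega^G_\alpha\|_{L^1(I^L_\beta[\varrho])}}\,dI^L_\beta[\varrho](\theta),\qquad \|\omega^G_\alpha\|_{L^1(I^L_\beta[\varrho])}:=\int\omega^G_\alpha\,dI^L_\beta[\varrho].$$ The constant $\widetilde C$: it is the constant, depending (for the fixed $L$, $\beta$, $d$) only on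 $R$, $M$, $\|\widetilde\varrho\|_{L^\infty(B_R(0))}$ and the Lipschitz constant $C_L$ in (W3), in the estimate $\big\|\int_{Q^L_\beta[\varrho]}f\varrho\,d\theta-\int_{Q^L_\beta[\widetilde\varrho]}f\widetilde\varrho\,d\theta\big\|_2\le\widetilde C\big(\|\varrho-\widetilde\varrho\|_{L^2(B_R(0))}+W_2(\varrho,\widetilde\varrho)\big)$ for functions $f$ bounded by $M$.
   Formalization: If L takes negative values, (W3) on [0,∞) does not control the level sets, and the claim can fail; the bound is stated for every constant C̃ for which the estimate in the context holds (with M ≥ max(1,R)), and existence of such C̃ is asserted when inf L ≥ 0. *)

(* Defs.v *)
From HB Require Import structures.
From mathcomp Require Import all_boot all_order all_algebra.
From mathcomp Require Import all_classical all_reals all_analysis.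
From mathcomp Require Import measurable_realfun.

Set Implicit Arguments.
Unset Strict Implicit.
Unset Printing Implicit Defensive.
Import Order.TTheory GRing.Theory Num.Theory.
Import numFieldNormedType.Exports.
Local Open Scope classical_set_scope.
Local Open Scope ring_scope.

(* R^d is ['rV[R]_d] with its library topology (the product topology) and its
   Borel sigma-algebra. *)
Section borel.
Variables (R : realType) (m n : nat).

HB.instance Definition _ := @isMeasurable.Build
  (sigma_display (@open 'M[R]_(m, n))) 'M[R]_(m, n)
  <<s @open 'M[R]_(m, n) >> (@sigma_algebra0 _ setT _)
  (@sigma_algebraC _ _) (@sigma_algebra_bigcup _ setT _).

End borel.

Section lebesgue_rV.
Variable R : realType.

Lemma measurable_open_mx (m n : nat) (A : set 'M[R]_(m, n)) :
  open A -> measurable A.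
Proof. by move=> oA; exact: sub_sigma_algebra. Qed.

Lemma measurable_fun_rV (d : measure_display) (T : measurableType d) (n : nat)
    (g : T -> 'rV[R]_n) :
  (forall j, measurable_fun setT (fun t => g t ord0 j)) ->
  measurable_fun setT g.
Proof.
move=> mg; apply: (@measurability _ _ _ _ _ _ (@open 'rV[R]_n)) => //.
move=> _ [U oU <-]; rewrite setTI.
pose c (q : 'rV[rat]_n) : 'rV[R]_n := map_mx ratr q.
pose V (i : 'rV[rat]_n * nat) := ball (c i.1) i.2.+1%:R^-1.
have -> : g @^-1` U = \bigcup_(i in [set i | V i `<=` U]) (g @^-1` V i).
  apply/seteqP; split=> [t Ut|t [i iU] /iU//].
  have /nbhs_ballP[e /= e0 eU] : nbhs (g t) U by exact: open_nbhs_nbhs.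
  have [N N0 Ne] : exists2 N : nat, true & N.+1%:R^-1 < e / 2 :> R.
    have e2 : 0 < e / 2 by rewrite divr_gt0.
    exists (Num.truncn (e / 2)^-1) => //.
    rewrite invf_plt ?posrE//; exact: truncnS_gt.
  have /choice[q qP] : forall j, exists q : rat,
      ball (g t ord0 j) N.+1%:R^-1 (ratr q : R).
    move=> j.
    have /rat_in_itvoo[q] : g t ord0 j < g t ord0 j + N.+1%:R^-1.
      by rewrite ltrDl invr_gt0.
    rewrite in_itv/= => /andP[q1 q2]; exists q.
    rewrite /ball/= distrC ger0_norm ?subr_ge0 ?(ltW q1)//.
    by rewrite ltrBlDl.
  have cB : ball (c (\row_j q j)) N.+1%:R^-1 (g t).
    split; first by rewrite invr_gt0.
    by move=> i j; rewrite !mxE (ord1 i); apply/ball_sym/qP.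
  exists (\row_j q j, N) => //= z Vz; apply: eU.
  rewrite (splitr e); apply: (@ball_triangle _ _ (c (\row_j q j))).
    by apply/ball_sym; apply: le_ball cB; exact: ltW.
  by apply: le_ball Vz; exact: ltW.
rewrite bigcup_mkcond; apply: countable_bigcupT_measurable => // -[q k].
case: ifPn => // _.
rewrite (_ : _ @^-1` _ = \bigcap_(j in [set: 'I_n])
    ((fun t => g t ord0 j) @^-1` ball (ratr (q ord0 j) : R) k.+1%:R^-1)).
  apply: fin_bigcap_measurable => // j _.
  rewrite -[X in measurable X]setTI; apply: mg => //.
  by rewrite ball_itv; exact: measurable_itv.
apply/seteqP; split=> t.
  by move=> [_ H] j _ /=; have := H ord0 j; rewrite mxE.
move=> H; split; first by rewrite invr_gt0.
by move=> i j; rewrite (ord1 i) mxE; exact: (H j).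
Qed.

Definition cons_rV (n : nat) (p : R * 'rV[R]_n) : 'rV[R]_n.+1 :=
  \row_j oapp (p.2 ord0) p.1 (unlift ord0 j).

Lemma measurable_coord (m n : nat) i j :
  measurable_fun setT (fun v : 'M[R]_(m, n) => v i j).
Proof.
apply: (measurability _ (RGenOpens.measurableE R)).
move=> _ [_ [a [b ->] <-]]; rewrite setTI; apply: measurable_open_mx.
by move/continuousP: (@coord_continuous R m n i j); apply; exact: interval_open.
Qed.

Lemma measurable_cons_rV n : measurable_fun setT (@cons_rV n).
Proof.
apply: measurable_fun_rV => j.
rewrite (_ : (fun _ => _) = fun p : R * 'rV[R]_n =>
  oapp (p.2 ord0) p.1 (unlift ord0 j)); last by apply/funext => p; rewrite mxE.
case: (unlift ord0 j) => [k|] /=; last exact: measurable_fst.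
exact: (measurableT_comp (@measurable_coord 1 n ord0 k) measurable_snd).
Qed.

Definition uncons_rV (n : nat) (v : 'rV[R]_n.+1) : R * 'rV[R]_n :=
  (v ord0 ord0, \row_j v ord0 (lift ord0 j)).

Lemma measurable_uncons_rV n : measurable_fun setT (@uncons_rV n).
Proof.
apply/measurable_fun_pairP; split; first exact: measurable_coord.
apply: measurable_fun_rV => j.
rewrite (_ : (fun _ => _) = fun v : 'rV[R]_n.+1 => v ord0 (lift ord0 j)).
  exact: measurable_coord.
by apply/funext => v /=; rewrite mxE.
Qed.

Lemma cons_rVK n : cancel (@cons_rV n) (@uncons_rV n).
Proof.
case=> x v; rewrite /uncons_rV /cons_rV mxE unlift_none/=; congr pair.
by apply/rowP => j; rewrite !mxE liftK.
Qed.

Section lebS.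
Variables (n : nat) (mu : {sigma_finite_measure set 'rV[R]_n -> \bar R}).

Definition lebS : set 'rV[R]_n.+1 -> \bar R :=
  pushforward (@lebesgue_measure R \x mu)%E (@cons_rV n).

Let lebS0 : lebS set0 = 0%E.
Proof. by rewrite /lebS /pushforward preimage_set0 measure0. Qed.

Let lebS_ge0 A : (0 <= lebS A)%E.
Proof. by rewrite /lebS /pushforward; exact: measure_ge0. Qed.

Let lebS_sigma_additive : semi_sigma_additive lebS.
Proof.
rewrite /lebS; apply: measure_semi_sigma_additive.
exact: measurable_cons_rV.
Qed.

HB.instance Definition _ :=
  isMeasure.Build _ _ _ lebS lebS0 lebS_ge0 lebS_sigma_additive.

Let lebS_sigma_finite : sigma_finite setT lebS.
Proof.
have /sigma_finiteP[F [FT ndF Foo]] := sigma_finiteT (@lebesgue_measure R).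
have /sigma_finiteP[G [GT ndG Goo]] := sigma_finiteT mu.
exists (fun k => @uncons_rV n @^-1` (F k `*` G k)).
  apply/seteqP; split=> // v _.
  have [i _ Fi] : (\bigcup_i F i) (uncons_rV v).1 by rewrite -FT.
  have [j _ Gj] : (\bigcup_j G j) (uncons_rV v).2 by rewrite -GT.
  exists (maxn i j) => //; split.
    by move: Fi; exact/subsetPset/ndF/leq_maxl.
  by move: Gj; exact/subsetPset/ndG/leq_maxr.
move=> k; have [mF oF] := Foo k; have [mG oG] := Goo k; split.
  rewrite -[X in measurable X]setTI; apply: measurable_uncons_rV => //.
  exact: measurableX.
rewrite /lebS /pushforward (_ : _ @^-1` _ = F k `*` G k); last first.
  apply/seteqP; split=> p;
    by have /= <- : (F k `*` G k) (uncons_rV (cons_rV p)) = (F k `*` G k) p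
      by rewrite cons_rVK.
by rewrite product_measure1E// lte_mul_pinfty// ge0_fin_numE.
Qed.

HB.instance Definition _ :=
  Measure_isSigmaFinite.Build _ _ _ lebS lebS_sigma_finite.

End lebS.

(* Lebesgue measure on R^n: the n-fold product of the one-dimensional one. *)
Fixpoint leb (n : nat) : {sigma_finite_measure set 'rV[R]_n -> \bar R} :=
  if n is k.+1 then lebS (leb k) else \d_(0 : 'rV[R]_0).

End lebesgue_rV.

Section euclidean.
Variables (R : realType) (d : nat).
Implicit Types (v : 'rV[R]_d) (B : set 'rV[R]_d) (f : 'rV[R]_d -> R).

(* The library norm of ['rV[R]_d] is the sup norm. *)
Definition enorm v : R := Num.sqrt (\sum_(i < d) v ord0 i ^+ 2).

Definition eball (r : R) : set 'rV[R]_d := [set v | enorm v <= r].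

Definition L2_on B f : \bar R :=
  Lnorm (leb R d) 2%:E (fun t => (\1_B t * f t)%:E).

Definition Linf_on B f : \bar R :=
  Lnorm (leb R d) +oo%E (fun t => (\1_B t * f t)%:E).

End euclidean.

Section probability_rV.
Variables (R : realType) (d : nat).
Implicit Types (P : probability 'rV[R]_d R) (L G : 'rV[R]_d -> R).
Implicit Types (rho : 'rV[R]_d -> R) (B : set 'rV[R]_d).

Definition vintegral (k : nat) P B (f : 'rV[R]_d -> 'rV[R]_k) : 'rV[R]_k :=
  \row_(i < k) (\int[P]_(t in B) f t ord0 i)%R.

Definition second_moment P : \bar R := (\int[P]_t (enorm t ^+ 2)%:E)%E.

(* [P] may have a singular part outside [B]; the values of [rho] outside [B]
   are irrelevant. *)
Definition density_on B P rho : Prop :=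
  [/\ measurable_fun setT rho, forall t, 0 <= rho t &
      forall A, measurable A -> A `<=` B ->
        P A = (\int[leb R d]_(t in A) (rho t)%:E)%E].

Definition coupling P P' (g : probability ('rV[R]_d * 'rV[R]_d)%type R) :
    Prop :=
  forall A, measurable A ->
    g (A `*` setT) = P A /\ g (setT `*` A) = P' A.

Definition wasserstein2 P P' : \bar R :=
  (ereal_inf [set (\int[g]_z (enorm (z.1 - z.2) ^+ 2)%:E)%E
             | g in coupling P P'] `^ 2^-1)%E.

(* Valued in [\bar R]: the infimum is over the empty set, hence [+oo], when
   [a = 1] and [L] is not essentially bounded above. *)
Definition quantile L P (a : R) : \bar R :=
  ereal_inf [set q%:E | q in [set q : R | (a%:E <= P [set t | L t <= q]%R)%E]].

Definition threshold L (beta dq : R) P : \bar R :=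
  ((2 / beta)%:E
    * \int[lebesgue_measure]_(a in `[(beta / 2)%R, beta]) quantile L P a
   + dq%:E)%E.

Definition Qset L (beta dq r : R) P : set 'rV[R]_d :=
  @eball R d r `&` [set t | ((L t)%:E <= threshold L beta dq P)%E].

Definition omega G (alpha : R) (t : 'rV[R]_d) : R := expR (- (alpha * G t)).

(* Integrating against the restriction of [P] to [Qset] is integrating [P] over
   [Qset]. *)
Definition consensus_point G L (alpha beta dq r : R) P : 'rV[R]_d :=
  let Q := Qset L beta dq r P in
  let Z := (\int[P]_(t in Q) omega G alpha t)%R in
  vintegral P Q (fun t => (omega G alpha t / Z) *: t).

Definition volume_sublevel L (r q : R) : R :=
  fine (leb R d (@eball R d r `&` [set t | L t <= q])).

(* [Ct] is an admissible constant in the stability estimate for integrals over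
   the quantile sets, for integrands bounded by [M] and second measures with
   density of sup norm [N] on the ball. *)
Definition quantile_estimate L (beta dq r M N Ct : R) : Prop :=
  forall P P' rho rho',
    (second_moment P < +oo)%E -> (second_moment P' < +oo)%E ->
    density_on (eball r) P rho -> density_on (eball r) P' rho' ->
    (Linf_on (eball r) rho < +oo)%E -> Linf_on (eball r) rho' = N%:E ->
  forall (k : nat) (f : 'rV[R]_d -> 'rV[R]_k),
    measurable_fun setT f ->
    (forall t, @eball R d r t -> enorm (f t) <= M) ->
  ((enorm (vintegral P (Qset L beta dq r P) f -
           vintegral P' (Qset L beta dq r P') f)%R)%:E
   <= Ct%:E * (L2_on (eball r) (fun t => (rho t - rho' t)%R)
               + wasserstein2 P P'))%E.

End probability_rV.

(* Main.v *)
Require Import Defs.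
From mathcomp Require Import all_boot all_order all_algebra.
From mathcomp Require Import all_classical all_reals all_analysis.
From mathcomp Require Import measurable_realfun ess_sup_inf ring lra.

Import Order.TTheory GRing.Theory Num.Theory.
Import numFieldNormedType.Exports.
Local Open Scope classical_set_scope.
Local Open Scope ring_scope.

(** Two facts are combined: stability of integrals over the quantile set, and
    stability of a quotient whose denominator is bounded away from zero.

    Stability of integrals. Write Q and Q' for the quantile sets of P and P',
    and let D be the sum of Vol(B)^(1/2) times the L^2 distance of the
    densities on the ball B and of N CL |s - s'|, where s and s' are the two
    thresholds. Every event A satisfies |P(A cap Q) - P'(A cap Q')| <= D:
    replacing P by P' on a part of B costs at most the L^1 distance of the
    densities ([density_le_L2]), and replacing Q by Q' costs at most the mass
    that P' gives to the symmetric difference of Q and Q'. That difference is a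
    shell between two level sets of L, so the Lipschitz continuity of the volume
    function bounds its volume ([leb_shell_le]) and the sup norm of the density
    bounds its mass ([density_le_Linf]). A bound that is uniform over events
    passes to integrals of bounded functions by the layer-cake formula
    ([Rintegral_dist_le_events]), and to vector-valued functions by duality
    ([enorm_vintegral_dist_le_events]).

    The thresholds are averages of quantiles, and the integral of the positive
    part of the difference of two quantile functions is at most that of the
    positive part of the difference of the distribution functions, since both
    measure the area between the same two graphs, the former only over part of
    the levels ([integral_quantile_le]). A
    coupling of P and P' bounds that area by the integral of |L(x) - L(y)|
    ([integral_sublevel_prob_le]), hence by C1 times the W_2 distance
    ([threshold_le]).

    The quotient. With w = exp(-alpha (G - inf G)), which takes values in
    ]0, 1], the consensus point is A / Z, where Z and A are the integrals over
    Q of w and of w(t) t; dividing numerator and denominator of the original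
    expression by the same constant changes nothing. Both integrands are bounded
    by max(1, r) on the ball, so the stability estimate controls |A - A'| and
    |Z - Z'|.
    Jensen's inequality gives 1/Z <= c_K ([integral_expR_ge]), and |A'| <= r Z'
    because the support lies in the ball of radius r; writing the difference of
    the quotients over the common denominator gives the constant
    c_K (1 + r) Ct ([enorm_ratio_dist], [consensus_point_dist]). *)

Set Implicit Arguments.
Unset Strict Implicit.
Unset Printing Implicit Defensive.

(** * Layer-cake formulas *)

Lemma measurable_between d (T : measurableType d) (R : realType)
    (u v : T -> R) :
  measurable_fun setT u -> measurable_fun setT v ->
  measurable [set z : T * R | u z.1 <= z.2 <= v z.1].
Proof.
move=> mu mv.
rewrite (_ : mkset _ = (fun z : T * R => (u z.1 <= z.2) && (z.2 <= v z.1))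
    @^-1` [set true]); last by apply/seteqP; split => z /=.
rewrite -[X in measurable X]setTI.
apply: (@measurable_and _ _ _ _ _) => //.
  by apply: measurable_fun_ler => //; exact: measurableT_comp.
by apply: measurable_fun_ler => //; exact: measurableT_comp.
Qed.

(** Both sides are the measure of the region between the graphs of [u] and [v];
    Tonelli computes it by slicing along either factor. The same formula serves
    as layer-cake formula, as comparison of quantile functions with distribution
    functions, and as comparison of distribution functions with couplings. *)
Lemma integral_between d (T : measurableType d) (R : realType)
    (m : {sigma_finite_measure set T -> \bar R}) (u v : T -> R) :
  measurable_fun setT u -> measurable_fun setT v ->
  (\int[@lebesgue_measure R]_x m [set t | (u t <= x <= v t)%R] =
   \int[m]_t (Num.max (v t - u t) 0)%R%:E)%E.
Proof.
move=> mu mv; have mB := measurable_between mu mv.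
have := indic_fubini_tonelli m (@lebesgue_measure R) mB.
rewrite indic_fubini_tonelli_FE// indic_fubini_tonelli_GE//= => H.
transitivity (\int[@lebesgue_measure R]_x
    (m \o ysection [set z : T * R | (u z.1 <= z.2 <= v z.1)%R]) x)%E.
  apply: eq_integral => x _ /=; congr (m _).
  by apply/seteqP; split => t; rewrite /ysection/= inE.
rewrite -H; apply: eq_integral => t _ /=.
rewrite (_ : xsection _ _ = `[u t, v t]%classic); last first.
  by apply/seteqP; split => x; rewrite /xsection/= in_itv/= inE.
rewrite lebesgue_measure_itv/= lte_fin; case: ltP => uv.
  by rewrite -EFinB max_l// subr_ge0 ltW.
by rewrite max_r// subr_le0.
Qed.

Lemma measurable_fun_between d (T : measurableType d) (R : realType)
    (m : {sigma_finite_measure set T -> \bar R}) (u v : T -> R) :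
  measurable_fun setT u -> measurable_fun setT v ->
  measurable_fun setT (fun x : R => m [set t | u t <= x <= v t]).
Proof.
move=> mu mv; have mB := measurable_between mu mv.
have := measurable_fun_ysection m mB.
apply: eq_measurable_fun => x _ /=; congr (m _).
by apply/seteqP; split => t; rewrite /ysection/= inE.
Qed.

Lemma layer_cake d (T : measurableType d) (R : realType)
    (m : {sigma_finite_measure set T -> \bar R}) (Q : set T) (g : T -> R) :
  measurable Q -> measurable_fun setT g -> (forall t, Q t -> 0 <= g t) ->
  measurable_fun setT
    (fun x : R => m ([set t | 0 <= x <= g t] `&` Q)) /\
  (\int[@lebesgue_measure R]_x m ([set t | (0 <= x <= g t)%R] `&` Q) =
   \int[m]_(t in Q) (g t)%:E)%E.
Proof.
move=> mQ mg g0.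
(* Outside [Q] the strip from [u] to [v] goes from 1 down to 0: it is empty. *)
pose u (t : T) : R := 1 - \1_Q t.
pose v (t : T) : R := \1_Q t * g t.
have mu : measurable_fun setT u by apply: measurable_funB.
have mv : measurable_fun setT v by apply: measurable_funM.
have E x : [set t | u t <= x <= v t] = [set t | 0 <= x <= g t] `&` Q.
  apply/seteqP; split => t; rewrite /u /v/= indicE.
    case: (boolP (t \in Q)) => [|_]; last first.
      by rewrite subr0 mul0r => /andP[]; lra.
    by rewrite inE => Qt; rewrite subrr mul1r.
  by move=> [h Qt]; rewrite mem_set// subrr mul1r.
split.
  have := measurable_fun_between m mu mv.
  by apply: eq_measurable_fun => x _; rewrite E.
under eq_integral do rewrite -E.
rewrite integral_between// [RHS]integral_mkcond; apply: eq_integral => t _.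
rewrite patchE /u /v indicE; case: ifPn => tQ.
  by rewrite mul1r subrr subr0 max_l//; apply: g0; rewrite inE in tQ.
by rewrite mul0r subr0 max_r//; lra.
Qed.

(** In the layer-cake formula only the levels between 0 and [b] contribute, and
    each of them costs at most [D]. *)
Lemma ge0_integral_le_events d (T : measurableType d) (R : realType)
    (m m' : probability T R) (Q Q' : set T) (D b : R) (g : T -> R) :
  measurable Q -> measurable Q' -> measurable_fun setT g ->
  0 <= D -> 0 <= b ->
  (forall A, measurable A -> (m (A `&` Q) <= m' (A `&` Q') + D%:E)%E) ->
  (forall t, Q t -> 0 <= g t <= b) -> (forall t, Q' t -> 0 <= g t) ->
  (\int[m]_(t in Q) (g t)%:E <= \int[m']_(t in Q') (g t)%:E + (b * D)%:E)%E.
Proof.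
move=> mQ mQ' mg D0 b0 mm' gQ gQ'.
have gQ0 t : Q t -> 0 <= g t by move=> /gQ /andP[].
have [m1 <-] := layer_cake m mQ mg gQ0.
have [m2 <-] := layer_cake m' mQ' mg gQ'.
have -> : (b * D)%:E =
    (\int[@lebesgue_measure R]_(x in `[0%R, b]) cst D%:E x)%E.
  rewrite integral_cst//= lebesgue_measure_itv/= lte_fin -EFinB subr0.
  by case: ltP => b0' //; [rewrite -EFinM mulrC|rewrite mule0; congr EFin; nra].
rewrite [X in (_ + X)%E]integral_mkcond -ge0_integralD//=; last 2 first.
- by move=> x _; rewrite erestrict_ge0//= => ?; rewrite lee_fin.
- by apply/(measurable_restrictT _ _).1 => //.
apply: ge0_le_integral => //.
- by apply: emeasurable_funD => //; apply/(measurable_restrictT _ _).1 => //.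
- move=> x _; rewrite patchE; case: ifPn => xb.
    apply: mm'.
    have x0 : 0 <= x by move: xb; rewrite inE/= in_itv/= => /andP[].
    rewrite (_ : mkset _ = g @^-1` `[x, +oo[).
      by rewrite -[X in measurable X]setTI; exact: mg.
    by apply/seteqP; split=> t /=; rewrite in_itv/= x0 andbT.
  rewrite (_ : _ `&` Q = set0) ?measure0 ?adde_ge0//.
  apply/seteqP; split => // t [/= /andP[x0 xg] Qt].
  move/negP: xb; apply; rewrite inE/= in_itv/= x0/=.
  by have /andP[_] := gQ _ Qt; exact: le_trans.
Qed.

Lemma bounded_integrable d (T : measurableType d) (R : realType)
    (m : probability T R) (Q : set T) (g : T -> R) (b : R) :
  measurable Q -> measurable_fun setT g -> (forall t, Q t -> `|g t| <= b) ->
  m.-integrable Q (EFin \o g).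
Proof.
move=> mQ mg gb; apply: measurable_bounded_integrable => //.
- by apply: le_lt_trans (probability_le1 m mQ) _; rewrite ltry.
- exact: measurable_funTS.
- exists b; split; first exact: num_real.
  by move=> x bx t Qt; apply: le_trans (gb _ Qt) (ltW bx).
Qed.

(** A function bounded by [b] is a function with values in [0, 2 b] minus the
    constant [b]; the first costs [2 b D], and the second costs [b D] because
    the masses of [Q] and [Q'] also differ by at most [D]. *)
Lemma Rintegral_dist_le_events d (T : measurableType d) (R : realType)
    (m m' : probability T R) (Q Q' : set T) (D b : R) (g : T -> R) :
  measurable Q -> measurable Q' -> measurable_fun setT g ->
  0 <= D -> 0 <= b ->
  (forall A, measurable A -> (m (A `&` Q) <= m' (A `&` Q') + D%:E)%E) ->
  (forall A, measurable A -> (m' (A `&` Q') <= m (A `&` Q) + D%:E)%E) ->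
  (forall t, Q t -> `|g t| <= b) -> (forall t, Q' t -> `|g t| <= b) ->
  `|\int[m]_(t in Q) g t - \int[m']_(t in Q') g t| <= 3 * b * D.
Proof.
move=> mQ mQ' mg D0 b0 mm' m'm gQ gQ'.
pose h t := g t + b.
have mh : measurable_fun setT h by exact: measurable_funD.
have hQ S : (forall t, S t -> `|g t| <= b) ->
    forall t, S t -> 0 <= h t <= 2 * b.
  by move=> gS t /gS; rewrite ler_norml /h => /andP[]; lra.
have hQ0 S : (forall t, S t -> `|g t| <= b) -> forall t, S t -> 0 <= h t.
  by move=> /hQ + t St => /(_ _ St) /andP[].
have hE (n : probability T R) S : measurable S ->
    (forall t, S t -> `|g t| <= b) ->
    (\int[n]_(t in S) (h t)%:E = (\int[n]_(t in S) g t + b * fine (n S))%:E)%E.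
  move=> mS gS; rewrite -Rintegral_cst// -RintegralD//; last 2 first.
  - exact: bounded_integrable gS.
  - by apply: (@bounded_integrable _ _ _ _ _ _ b) => // t _; rewrite ger0_norm.
  rewrite fineK//; apply: integrable_fin_num => //.
  apply: (@bounded_integrable _ _ _ _ _ _ (2 * b)) => // t St.
  by have /andP[? ?] := hQ _ gS _ St; rewrite ger0_norm.
have b20 : 0 <= 2 * b by lra.
have := ge0_integral_le_events mQ mQ' mh D0 b20 mm' (hQ _ gQ) (hQ0 _ gQ').
have := ge0_integral_le_events mQ' mQ mh D0 b20 m'm (hQ _ gQ') (hQ0 _ gQ).
rewrite !hE// -!EFinD !lee_fin => H1 H2.
have := mm' _ measurableT; have := m'm _ measurableT; rewrite !setTI.
rewrite -(fineK (fin_num_measure m _ mQ)) -(fineK (fin_num_measure m' _ mQ')).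
rewrite -!EFinD !lee_fin => H3 H4.
by rewrite ler_norml; apply/andP; split; nra.
Qed.

(** * Euclidean geometry and measurability on row vectors *)

Definition dot (R : realType) (k : nat) (u v : 'rV[R]_k) : R :=
  \sum_(i < k) u ord0 i * v ord0 i.

Lemma dotBr (R : realType) (k : nat) (u v w : 'rV[R]_k) :
  dot u (v - w) = dot u v - dot u w.
Proof.
rewrite /dot -sumrB; apply: eq_bigr => i _.
by rewrite !mxE mulrDr mulrN.
Qed.

Lemma dotZr (R : realType) (k : nat) (u v : 'rV[R]_k) a :
  dot u (a *: v) = a * dot u v.
Proof.
by rewrite /dot mulr_sumr; apply: eq_bigr => i _; rewrite !mxE mulrCA.
Qed.

Lemma enorm_ge0 (R : realType) (k : nat) (v : 'rV[R]_k) : 0 <= enorm v.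
Proof. exact: sqrtr_ge0. Qed.

Lemma enorm_sqr (R : realType) (k : nat) (v : 'rV[R]_k) :
  enorm v ^+ 2 = dot v v.
Proof.
rewrite sqr_sqrtr; last by apply: sumr_ge0 => i _; exact: sqr_ge0.
by apply: eq_bigr => i _; rewrite expr2.
Qed.

Lemma enormZ (R : realType) (k : nat) (v : 'rV[R]_k) a :
  enorm (a *: v) = `|a| * enorm v.
Proof.
rewrite /enorm -sqrtr_sqr -sqrtrM ?sqr_ge0//; congr Num.sqrt.
by rewrite mulr_sumr; apply: eq_bigr => i _; rewrite mxE exprMn.
Qed.

Lemma dot_le_enorm (R : realType) (k : nat) (u v : 'rV[R]_k) :
  `|dot u v| <= enorm u * enorm v.
Proof.
rewrite -ler_sqr ?nnegrE ?mulr_ge0 ?enorm_ge0// real_normK ?num_real// exprMn.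
set a := enorm u ^+ 2; set b := enorm v ^+ 2; set c := dot u v.
(* The quadratic form [|x u - y v|^2] is nonnegative. *)
have q x y : 0 <= x ^+ 2 * a - 2 * (x * y * c) + y ^+ 2 * b.
  suff -> : x ^+ 2 * a - 2 * (x * y * c) + y ^+ 2 * b =
      \sum_(i < k) (x * u ord0 i - y * v ord0 i) ^+ 2.
    by apply: sumr_ge0 => i _; exact: sqr_ge0.
  rewrite /a /b /c !enorm_sqr /dot !mulr_sumr -sumrB -big_split/=.
  by apply: eq_bigr => i _; ring.
have a0 : 0 <= a by exact: sqr_ge0.
have b0 : 0 <= b by exact: sqr_ge0.
have [b_eq0|b_neq0] := eqVneq b 0.
  by have := q c (a + 1); rewrite b_eq0; nra.
have b_gt0 : 0 < b by rewrite lt0r b_neq0.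
rewrite -subr_ge0 -(pmulr_rge0 _ b_gt0).
by have := q b c; lra.
Qed.

(** Norm bounds on a vector are obtained by pairing the vector with itself,
    which reduces them to scalar inequalities. *)
Lemma le_enorm_of_dot (R : realType) (k : nat) (v : 'rV[R]_k) (D : R) :
  0 <= D -> dot v v <= enorm v * D -> enorm v <= D.
Proof.
move=> D0; rewrite -enorm_sqr expr2.
have := enorm_ge0 v; rewrite le_eqVlt => /predU1P[<- //|v0].
by rewrite ler_pM2l.
Qed.

Lemma enorm_const1 (R : realType) (x : R) :
  enorm (const_mx x : 'rV[R]_1) = `|x|.
Proof. by rewrite /enorm big_ord_recl big_ord0 addr0 mxE sqrtr_sqr. Qed.

Lemma continuous_measurable_rV (R : realType) (d : nat) (f : 'rV[R]_d -> R) :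
  continuous f -> measurable_fun setT f.
Proof.
move=> cf; apply: (measurability _ (RGenOpens.measurableE R)).
move=> _ [_ [a [b ->] <-]]; rewrite setTI; apply: measurable_open_mx.
by move/continuousP: cf; apply; exact: interval_open.
Qed.

Lemma measurable_dot d (T : measurableType d) (R : realType) (k : nat)
    (f g : T -> 'rV[R]_k) :
  measurable_fun setT f -> measurable_fun setT g ->
  measurable_fun setT (fun t => dot (f t) (g t)).
Proof.
move=> mf mg; apply: measurable_sum => i; apply: measurable_funM.
  exact: (measurableT_comp (@measurable_coord R 1 k ord0 i) mf).
exact: (measurableT_comp (@measurable_coord R 1 k ord0 i) mg).
Qed.

(** The square root is a real power, a function known to be measurable. *)
Lemma measurable_enorm d (T : measurableType d) (R : realType) (k : nat)
    (f : T -> 'rV[R]_k) :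
  measurable_fun setT f -> measurable_fun setT (fun t => enorm (f t)).
Proof.
move=> mf.
have -> : (fun t => enorm (f t)) = (fun t => dot (f t) (f t) `^ 2^-1).
  apply/funext => t; rewrite -enorm_sqr powR12_sqrt ?sqr_ge0//.
  by rewrite sqrtr_sqr ger0_norm ?enorm_ge0.
by apply: (measurableT_comp (measurable_powR _)) => //; exact: measurable_dot.
Qed.

Lemma measurable_pair_sub (R : realType) (k : nat) :
  measurable_fun setT (fun z : 'rV[R]_k * 'rV[R]_k => z.1 - z.2).
Proof.
apply: measurable_fun_rV => j; under eq_fun do rewrite !mxE.
by apply: measurable_funB;
  apply: (measurableT_comp (@measurable_coord R 1 k ord0 j)).
Qed.

Lemma measurable_eball (R : realType) (d : nat) (r : R) :
  measurable (@eball R d r).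
Proof.
rewrite /eball (_ : mkset _ = (@enorm R d) @^-1` `]-oo, r]); last first.
  by apply/seteqP; split=> t /=; rewrite in_itv/=.
by rewrite -[X in measurable X]setTI; exact: measurable_enorm.
Qed.

Lemma measurable_cap_eball_sublevel (R : realType) (d : nat) (r : R)
    (L : 'rV[R]_d -> R) (q : \bar R) :
  continuous L -> measurable (@eball R d r `&` [set t | ((L t)%:E <= q)%E]).
Proof.
move=> /continuous_measurable_rV mL; apply: measurableI.
  exact: measurable_eball.
rewrite (_ : mkset _ = (EFin \o L) @^-1` `]-oo, q]%classic); last first.
  by apply/seteqP; split=> t /=; rewrite in_itv/=.
rewrite -[X in measurable X]setTI.
by move/measurable_EFinP: mL; apply => //; exact: emeasurable_itv.
Qed.

Lemma coord_le_enorm (R : realType) (d : nat) (v : 'rV[R]_d) i :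
  `|v ord0 i| <= enorm v.
Proof.
rewrite -sqrtr_sqr; apply: ler_wsqrtr.
by rewrite (bigD1 i)//= lerDl; apply: sumr_ge0 => j _; exact: sqr_ge0.
Qed.

Lemma measurable_box (R : realType) (d : nat) (r : R) :
  measurable [set v : 'rV[R]_d | forall i, `|v ord0 i| <= r].
Proof.
rewrite (_ : mkset _ = \bigcap_(i in [set: 'I_d])
    ((fun v : 'rV[R]_d => v ord0 i) @^-1` `[- r, r])); last first.
  apply/seteqP; split=> v /= vr i.
    by move=> _ /=; rewrite in_itv/= -ler_norml.
  by have := vr i I; rewrite /= in_itv/= -ler_norml.
apply: fin_bigcap_measurable => // i _.
by rewrite -[X in measurable X]setTI; exact: measurable_coord.
Qed.

(** By induction on the dimension, peeling off the first coordinate as in the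
    construction of the product measure. *)
Lemma leb_box_lty (R : realType) (d : nat) (r : R) :
  (leb R d [set v | forall i, (`|v ord0 i| <= r)%R] < +oo)%E.
Proof.
elim: d => [|d IH] /=; first by rewrite diracE ltry.
rewrite /lebS /pushforward.
rewrite (_ : _ @^-1` _ =
    `[- r, r]%classic `*` [set v : 'rV[R]_d | forall i, `|v ord0 i| <= r]).
  rewrite product_measure1E//; last exact: measurable_box.
  rewrite lte_mul_pinfty ?ge0_fin_numE//= lebesgue_measure_itv/=;
    by case: ifPn => // _; rewrite -EFinB ltry.
apply/seteqP; split=> -[x v] /=.
  move=> H; split.
    by have := H ord0; rewrite mxE unlift_none/= in_itv/= ler_norml.
  by move=> i; have := H (lift ord0 i); rewrite mxE liftK.
move=> [xr vr] i; rewrite mxE; case: unliftP => [j _|_] /=; first exact: vr.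
by rewrite ler_norml; rewrite in_itv in xr.
Qed.

Lemma leb_eball_lty (R : realType) (d : nat) (r : R) :
  (leb R d (@eball R d r) < +oo)%E.
Proof.
apply: le_lt_trans (leb_box_lty d r); apply: le_measure; rewrite ?inE.
- exact: measurable_eball.
- exact: measurable_box.
- by move=> v vr i; apply: le_trans (coord_le_enorm v i) vr.
Qed.

(** * Vector-valued integrals *)

Lemma dot_vintegral (R : realType) (d k : nat) (P : probability 'rV[R]_d R)
    (Q : set 'rV[R]_d) (f : 'rV[R]_d -> 'rV[R]_k) (b : R) (u : 'rV[R]_k) :
  measurable Q -> measurable_fun setT f ->
  (forall t, Q t -> enorm (f t) <= b) ->
  dot u (vintegral P Q f) = \int[P]_(t in Q) dot u (f t).
Proof.
move=> mQ mf fb.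
have mfi i : measurable_fun setT (fun t => f t ord0 i).
  exact: (measurableT_comp (@measurable_coord R 1 k ord0 i) mf).
have fi i : P.-integrable Q (EFin \o (fun t => f t ord0 i)).
  apply: bounded_integrable => // t /fb; apply: le_trans.
  exact: coord_le_enorm.
rewrite /Rintegral /dot; under [in RHS]eq_integral do rewrite -sumEFin.
rewrite integral_sum//; last first.
  move=> i; apply: eq_integrable (integrableZl mQ (u ord0 i) (fi i)) => //.
rewrite -sum_fine => [|i _]; last first.
  apply: integrable_fin_num => //.
  apply: eq_integrable (integrableZl mQ (u ord0 i) (fi i)) => //.
apply: eq_bigr => i _; rewrite mxE -RintegralZl//.
Qed.

(** Pairing the integral with itself turns the claim into a pointwise
    Cauchy-Schwarz inequality under the integral sign. *)
Lemma enorm_vintegral_le (R : realType) (d k : nat)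
    (P : probability 'rV[R]_d R) (Q : set 'rV[R]_d) (f : 'rV[R]_d -> 'rV[R]_k)
    (h : 'rV[R]_d -> R) (b : R) :
  measurable Q -> measurable_fun setT f -> measurable_fun setT h ->
  (forall t, Q t -> enorm (f t) <= h t <= b) ->
  enorm (vintegral P Q f) <= \int[P]_(t in Q) h t.
Proof.
move=> mQ mf mh fhb.
have fh t : Q t -> enorm (f t) <= h t by move=> /fhb/andP[].
have hb t : Q t -> `|h t| <= b.
  by move=> /fhb/andP[fht]; rewrite ger0_norm// (le_trans _ fht) ?enorm_ge0.
have fb t : Q t -> enorm (f t) <= b by move=> /fhb/andP[]; exact: le_trans.
have ih : P.-integrable Q (EFin \o h) by exact: bounded_integrable hb.
set v := vintegral P Q f.
have dv t : Q t -> `|dot v (f t)| <= enorm v * h t.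
  move=> Qt; apply: le_trans (dot_le_enorm _ _) _.
  by apply: ler_wpM2l; [exact: enorm_ge0|exact: fh].
apply: le_enorm_of_dot.
  by apply: Rintegral_ge0 => t Qt; apply: le_trans (fh _ Qt); exact: enorm_ge0.
rewrite [X in X <= _](dot_vintegral P v mQ mf fb) -RintegralZl//.
apply: le_Rintegral => //.
- apply: (@bounded_integrable _ _ _ _ _ _ (enorm v * b)) => //.
    by apply: measurable_dot.
  move=> t Qt; apply: le_trans (dv _ Qt) _.
  by apply: ler_wpM2l; [exact: enorm_ge0|move: (fhb _ Qt) => /andP[]].
- by apply: eq_integrable (integrableZl mQ (enorm v) ih).
- by move=> t /dv; apply: le_trans; exact: ler_norm.
Qed.

(** The pairing of [f] with the difference [v] of the two integrals is a scalar
    function bounded by [enorm v * b], so that the scalar estimate gives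
    [enorm v ^+ 2 <= enorm v * (3 * b * D)]. *)
Lemma enorm_vintegral_dist_le_events (R : realType) (d k : nat)
    (P P' : probability 'rV[R]_d R) (Q Q' : set 'rV[R]_d) (D b : R)
    (f : 'rV[R]_d -> 'rV[R]_k) :
  measurable Q -> measurable Q' -> measurable_fun setT f ->
  0 <= D -> 0 <= b ->
  (forall A, measurable A -> (P (A `&` Q) <= P' (A `&` Q') + D%:E)%E) ->
  (forall A, measurable A -> (P' (A `&` Q') <= P (A `&` Q) + D%:E)%E) ->
  (forall t, Q t -> enorm (f t) <= b) -> (forall t, Q' t -> enorm (f t) <= b) ->
  enorm (vintegral P Q f - vintegral P' Q' f) <= 3 * b * D.
Proof.
move=> mQ mQ' mf D0 b0 PP' P'P fQ fQ'.
set v := _ - _; apply: le_enorm_of_dot; first by rewrite !mulr_ge0.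
rewrite {2}/v dotBr (dot_vintegral P v mQ mf fQ).
rewrite (dot_vintegral P' v mQ' mf fQ').
apply: le_trans (ler_norm _) _.
have dv S : (forall t, S t -> enorm (f t) <= b) ->
    forall t, S t -> `|dot v (f t)| <= enorm v * b.
  move=> fS t /fS ftb; apply: le_trans (dot_le_enorm _ _) _.
  by apply: ler_wpM2l => //; exact: enorm_ge0.
apply: le_trans (@Rintegral_dist_le_events _ _ _ P P' Q Q' D (enorm v * b)
  (fun t => dot v (f t)) mQ mQ' _ D0 _ PP' P'P (dv _ fQ) (dv _ fQ')) _.
- exact: measurable_dot.
- by rewrite mulr_ge0 ?enorm_ge0.
- by rewrite le_eqVlt; apply/orP; left; apply/eqP; ring.
Qed.

(** * Stability of the normalized weighted mean *)

Lemma measurable_Qset (R : realType) (d : nat) (L : 'rV[R]_d -> R)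
    (beta dq r : R) (P : probability 'rV[R]_d R) :
  continuous L -> measurable (Qset L beta dq r P).
Proof. exact: measurable_cap_eball_sublevel. Qed.

Lemma measurable_scale_id (R : realType) (d : nat) (w : 'rV[R]_d -> R) :
  measurable_fun setT w -> measurable_fun setT (fun t : 'rV[R]_d => w t *: t).
Proof.
move=> mw; apply: measurable_fun_rV => j; under eq_fun do rewrite mxE.
by apply: measurable_funM => //; exact: measurable_coord.
Qed.

(** The factor [k] cancels between the weight and its normalization. This allows
    weights with values in [0, 1], as required for bounds that are independent
    of the infimum of [G]. *)
Lemma consensus_point_rescaled (R : realType) (d : nat)
    (G L w : 'rV[R]_d -> R) (alpha beta dq r k : R) (P : probability 'rV[R]_d R)
    (Q := Qset L beta dq r P) :
  continuous L -> measurable_fun setT w -> (forall t, 0 <= w t <= 1) ->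
  k != 0 -> (forall t, omega G alpha t = k * w t) ->
  consensus_point G L alpha beta dq r P =
  (\int[P]_(t in Q) w t)^-1 *: vintegral P Q (fun t => w t *: t).
Proof.
move=> cL mw w01 k0 omegaE.
have mQ : measurable Q by exact: measurable_Qset.
have w1 t : Q t -> `|w t| <= 1.
  by move=> _; have /andP[w0 w1] := w01 t; rewrite ger0_norm.
have ZE : \int[P]_(t in Q) omega G alpha t = k * \int[P]_(t in Q) w t.
  rewrite -RintegralZl//; first by apply: eq_Rintegral => t _.
  exact: bounded_integrable w1.
rewrite /consensus_point -/Q ZE; apply/rowP => i.
rewrite !mxE -[RHS]RintegralZl//; last first.
  apply: (@bounded_integrable _ _ _ _ _ _ r) => //.
    under eq_fun do rewrite mxE.
    by apply: measurable_funM => //; exact: measurable_coord.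
  move=> t Qt; have [tr _] := Qt; rewrite mxE normrM -[r]mul1r ler_pM//.
    exact: w1.
  exact: le_trans (coord_le_enorm _ _) tr.
apply: eq_Rintegral => t _; rewrite !mxE omegaE.
have [->|Z0] := eqVneq (\int[P]_(t in Q) w t) 0.
  by rewrite mulr0 invr0 !(mulr0, mul0r).
by field; rewrite Z0.
Qed.

(** Jensen's inequality for the restriction of [P] to [Q], obtained by
    integrating the tangent line of the exponential at [- s] with
    [s = a / c * C4 * (1 + K)]: the choice of [s] makes the linear term
    nonnegative once [P Q >= c]. *)
Lemma integral_expR_ge (R : realType) (d : nat) (P : probability 'rV[R]_d R)
    (Q : set 'rV[R]_d) (g : 'rV[R]_d -> R) (a r C4 K c : R) :
  measurable Q -> Q `<=` eball r -> measurable_fun setT g ->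
  0 <= a -> 0 <= C4 ->
  (forall t, 0 <= g t <= C4 * (1 + enorm t ^+ 2)) ->
  (second_moment P <= K%:E)%E -> 0 < c -> (c%:E <= P Q)%E ->
  c * expR (- (a / c * C4 * (1 + K))) <= \int[P]_(t in Q) expR (- (a * g t)).
Proof.
move=> mQ Qr mg a0 C40 g4 PK c0 cP.
set s := a / c * C4 * (1 + K).
have me : measurable_fun setT (fun t : 'rV[R]_d => enorm t ^+ 2).
  by apply: measurable_funX; exact: measurable_enorm.
have eQ t : Q t -> `|enorm t ^+ 2| <= r ^+ 2.
  move=> /Qr tr; rewrite ger0_norm ?sqr_ge0// ler_sqr ?nnegrE ?enorm_ge0//.
  exact: le_trans (enorm_ge0 t) tr.
have ie : P.-integrable Q (EFin \o (fun t => enorm t ^+ 2)).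
  exact: bounded_integrable eQ.
have mw : measurable_fun setT (fun t => expR (- (a * g t))).
  apply: measurableT_comp => //; apply: measurableT_comp => //.
  by apply: measurable_funM.
have iw : P.-integrable Q (EFin \o (fun t => expR (- (a * g t)))).
  apply: (@bounded_integrable _ _ _ _ _ _ 1) => // t _.
  rewrite ger0_norm ?expR_ge0// -expR0 ler_expR oppr_le0 mulr_ge0//.
  by have /andP[] := g4 t.
set S := \int[P]_(t in Q) enorm t ^+ 2.
set p := fine (P Q).
have pc : c <= p.
  by rewrite -lee_fin /p fineK//; exact: fin_num_measure.
have p1 : p <= 1.
  by rewrite -lee_fin /p fineK; [exact: probability_le1|exact: fin_num_measure].
have SK : S <= K.
  rewrite -lee_fin /S fineK; last exact: integrable_fin_num.
  apply: le_trans PK; apply: ge0_subset_integral => //.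
  - by apply/measurable_EFinP.
  - by move=> t _; rewrite lee_fin sqr_ge0.
pose b := 1 + s - a * C4.
have iSe k : P.-integrable Q (EFin \o (fun t => k * enorm t ^+ 2)).
  by apply: eq_integrable (integrableZl mQ k ie).
have icst k : P.-integrable Q (EFin \o (fun _ => k : R)).
  exact: finite_measure_integrable_cst.
have lowerE : \int[P]_(t in Q) (expR (- s) * (b - a * C4 * enorm t ^+ 2)) =
    expR (- s) * (b * p - a * C4 * S).
  rewrite RintegralZl//; last first.
    have := integrableB mQ (icst b) (iSe (a * C4)).
    by apply: eq_integrable.
  by rewrite RintegralB// Rintegral_cst// RintegralZl.
(* The integral of the tangent line is at least [c * expR (- s)]. *)
apply: (@le_trans _ _ (expR (- s) * (b * p - a * C4 * S))).
  rewrite mulrC ler_pM2l ?expR_gt0// /b.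
  have sc : s * c = a * C4 * (1 + K).
    by rewrite /s; field; rewrite gt_eqF.
  have S0 : 0 <= S by apply: Rintegral_ge0 => t _; exact: sqr_ge0.
  have aC : 0 <= a * C4 by rewrite mulr_ge0.
  have s0 : 0 <= s by rewrite /s !mulr_ge0// ?invr_ge0 ?ltW//; lra.
  have h1 : s * c <= s * p by exact: ler_wpM2l.
  have h2 : a * C4 * (p + S) <= a * C4 * (1 + K) by apply: ler_wpM2l => //; lra.
  lra.
rewrite -lowerE; apply: le_Rintegral => //.
  have := integrableZl mQ (expR (- s)) (integrableB mQ (icst b) (iSe (a * C4))).
  by apply: eq_integrable.
move=> t _.
have /andP[_ gt4] := g4 t.
rewrite (_ : - (a * g t) = - s + (s - a * g t)); last by ring.
rewrite expRD ler_pM2l ?expR_gt0//; apply: le_trans (expR_ge1Dx _).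
have : a * g t <= a * (C4 * (1 + enorm t ^+ 2)) by exact: ler_wpM2l.
rewrite /b; lra.
Qed.

(** Write the difference of the quotients as
    [Z^-1 *: ((A - A') - (Z'^-1 * (Z - Z')) *: A')]. *)
Lemma enorm_ratio_dist (R : realType) (d : nat) (A A' : 'rV[R]_d)
    (Z Z' r : R) :
  0 < Z -> 0 < Z' -> enorm A' <= r * Z' ->
  enorm (Z^-1 *: A - Z'^-1 *: A') <= Z^-1 * (enorm (A - A') + r * `|Z - Z'|).
Proof.
move=> Z0 Z'0 A'r.
have Z0' : 0 <= Z^-1 by rewrite invr_ge0 ltW.
have r0 : 0 <= r by rewrite -(pmulr_lge0 _ Z'0) (le_trans _ A'r)// enorm_ge0.
set v := _ - _.
have vE : v = Z^-1 *: ((A - A') - (Z'^-1 * (Z - Z')) *: A').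
  apply/rowP => i; rewrite !mxE; field.
  by rewrite !gt_eqF.
apply: le_enorm_of_dot.
  by rewrite mulr_ge0// addr_ge0 ?enorm_ge0// mulr_ge0.
rewrite {2}vE dotZr dotBr dotZr mulrCA ler_wpM2l// mulrDr.
have h1 := le_trans (ler_norm _) (dot_le_enorm v (A - A')).
have h2 : - (Z'^-1 * (Z - Z') * dot v A') <= enorm v * (r * `|Z - Z'|).
  apply: le_trans (ler_norm _) _.
  rewrite normrN !normrM (ger0_norm (_ : 0 <= Z'^-1)) ?invr_ge0 ?(ltW Z'0)//.
  have : `|dot v A'| <= enorm v * (r * Z').
    by apply: le_trans (dot_le_enorm _ _) _; rewrite ler_wpM2l ?enorm_ge0.
  rewrite -(ler_pM2l (_ : 0 < Z'^-1)) ?invr_gt0// => h.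
  have := ler_wpM2l (normr_ge0 (Z - Z')) h.
  have -> : Z'^-1 * (enorm v * (r * Z')) = enorm v * r by field; rewrite gt_eqF.
  by lra.
lra.
Qed.

Lemma vintegral_const1 (R : realType) (d : nat) (P : probability 'rV[R]_d R)
    (Q : set 'rV[R]_d) (w : 'rV[R]_d -> R) :
  vintegral P Q (fun t => const_mx (w t) : 'rV[R]_1) =
  const_mx (\int[P]_(t in Q) w t).
Proof.
by apply/rowP => i; rewrite !mxE; apply: eq_Rintegral => t _; rewrite mxE.
Qed.

(** The estimate is applied to the two integrands [w t *: t] and [w t], the
    latter seen as a vector with one entry. The bound [X] is kept abstract,
    since it may be infinite. *)
Lemma consensus_point_dist (R : realType) (d : nat) (G L : 'rV[R]_d -> R)
    (alpha beta dq r C4 K c : R) (P P' : probability 'rV[R]_d R) (X : \bar R)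
    (Q := Qset L beta dq r P) (Q' := Qset L beta dq r P') :
  0 < alpha -> 0 < r -> 0 <= C4 -> 0 < c ->
  continuous L -> continuous G -> has_lbound (range G) ->
  (forall t, G t - inf (range G) <= C4 * (1 + enorm t ^+ 2)) ->
  (second_moment P <= K%:E)%E -> (second_moment P' <= K%:E)%E ->
  (c%:E <= P Q)%E -> (c%:E <= P' Q')%E ->
  (forall (k : nat) (f : 'rV[R]_d -> 'rV[R]_k),
    measurable_fun setT f ->
    (forall t, eball r t -> enorm (f t) <= Num.max 1 r) ->
    ((enorm (vintegral P Q f - vintegral P' Q' f))%:E <= X)%E) ->
  ((enorm (consensus_point G L alpha beta dq r P -
           consensus_point G L alpha beta dq r P')%R)%:E <=
   (c^-1 * expR (alpha / c * C4 * (1 + K)) * (1 + r))%:E * X)%E.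
Proof.
move=> a0 r0 C40 c0 cL cG Gl G4 PK P'K cP cP' est.
pose g t := G t - inf (range G).
pose w t := expR (- (alpha * g t)).
have g0 t : 0 <= g t by rewrite subr_ge0; apply: ge_inf => //; exists t.
have g04 t : 0 <= g t <= C4 * (1 + enorm t ^+ 2) by rewrite g0 G4.
have mg : measurable_fun setT g.
  by apply: measurable_funB => //; exact: continuous_measurable_rV.
have mw : measurable_fun setT w.
  apply: measurableT_comp => //; apply: measurableT_comp => //.
  by apply: measurable_funM.
have w01 t : 0 <= w t <= 1.
  by rewrite expR_ge0/= -expR0 ler_expR oppr_le0 mulr_ge0// ltW.
have omegaE t : omega G alpha t = expR (- (alpha * inf (range G))) * w t.
  by rewrite /omega /w -expRD; congr expR; rewrite /g; ring.
have k0 : expR (- (alpha * inf (range G))) != 0 by rewrite gt_eqF ?expR_gt0.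
have mQ : measurable Q by exact: measurable_Qset.
have mQ' : measurable Q' by exact: measurable_Qset.
have mf : measurable_fun setT (fun t : 'rV[R]_d => w t *: t).
  exact: measurable_scale_id.
rewrite !(consensus_point_rescaled _ _ _ _ cL mw w01 k0 omegaE) -/Q -/Q'.
set Z := \int[P]_(t in Q) w t; set Z' := \int[P']_(t in Q') w t.
set A := vintegral P Q _; set A' := vintegral P' Q' _.
pose s := alpha / c * C4 * (1 + K).
have ces : 0 < c * expR (- s) by rewrite mulr_gt0 ?expR_gt0.
have Zge : c * expR (- s) <= Z.
  apply: (@integral_expR_ge _ _ _ _ _ _ r _ _ _ mQ) g04 PK c0 cP => //.
    by move=> t [].
  exact: ltW.
have Z'ge : c * expR (- s) <= Z'.
  apply: (@integral_expR_ge _ _ _ _ _ _ r _ _ _ mQ') g04 P'K c0 cP' => //.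
    by move=> t [].
  exact: ltW.
have Z0 : 0 < Z by exact: lt_le_trans Zge.
have Z'0 : 0 < Z' by exact: lt_le_trans Z'ge.
have Zc : Z^-1 <= c^-1 * expR s.
  have -> : c^-1 * expR s = (c * expR (- s))^-1 by rewrite expRN invfM invrK.
  by rewrite lef_pV2.
have wr t : eball r t -> enorm (w t *: t) <= r * w t <= r.
  move=> tr; have /andP[w0 w1] := w01 t.
  rewrite enormZ ger0_norm// [r * _]mulrC ler_wpM2l//=.
  by rewrite -[leRHS]mul1r ler_wpM2r// ltW.
have A'r : enorm A' <= r * Z'.
  rewrite -RintegralZl//; last first.
    apply: (@bounded_integrable _ _ _ _ _ _ 1) => // t _.
    by have /andP[? ?] := w01 t; rewrite ger0_norm.
  apply: (@enorm_vintegral_le _ _ _ _ _ _ _ r) => //.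
    by apply: measurable_funM.
  by move=> t [tr _]; exact: wr.
have XA : ((enorm (A - A'))%:E <= X)%E.
  apply: est => // t /wr/andP[h1 h2].
  by rewrite le_max (le_trans h1 h2) orbT.
have XZ : (`|Z - Z'|%:E <= X)%E.
  have := est 1%N (fun t => const_mx (w t)).
  rewrite !vintegral_const1 (_ : const_mx _ - const_mx _ = const_mx (Z - Z')).
    rewrite enorm_const1; apply.
      by apply: measurable_fun_rV => j; under eq_fun do rewrite mxE.
    move=> t _; rewrite enorm_const1; have /andP[w0 w1] := w01 t.
    by rewrite ger0_norm// le_max w1.
  by apply/rowP => i; rewrite !mxE.
have C0 : 0 < c^-1 * expR s * (1 + r).
  by rewrite !mulr_gt0 ?invr_gt0 ?expR_gt0// addr_gt0.
case: X XA XZ {est} => [x| |]; rewrite ?leeNy_eq// => XA XZ; last first.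
  by rewrite gt0_muley ?leey// lte_fin.
rewrite -EFinM lee_fin.
apply: le_trans (enorm_ratio_dist A Z0 Z'0 A'r) _.
rewrite !lee_fin in XA XZ.
rewrite -[leRHS]mulrA; apply: ler_pM; [by rewrite invr_ge0 ltW| |exact: Zc|].
  by rewrite addr_ge0 ?enorm_ge0// mulr_ge0// ltW.
by rewrite mulrDl mul1r lerD// ler_wpM2l// ltW.
Qed.

(** * Quantiles and couplings *)

Definition sublevel_prob (R : realType) (d : nat) (L : 'rV[R]_d -> R)
  (P : probability 'rV[R]_d R) (x : R) : R := fine (P [set t | L t <= x]).

Lemma measurable_sublevel (R : realType) (d : nat) (L : 'rV[R]_d -> R) (x : R) :
  continuous L -> measurable [set t | L t <= x].
Proof.
move=> /continuous_measurable_rV mL.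
rewrite (_ : mkset _ = L @^-1` `]-oo, x]); last first.
  by apply/seteqP; split=> t /=; rewrite in_itv/=.
by rewrite -[X in measurable X]setTI; exact: mL.
Qed.

Lemma EFin_sublevel_prob (R : realType) (d : nat) (L : 'rV[R]_d -> R)
    (P : probability 'rV[R]_d R) (x : R) : continuous L ->
  (sublevel_prob L P x)%:E = P [set t | L t <= x].
Proof.
move=> cL; rewrite fineK//; apply: fin_num_measure.
exact: measurable_sublevel.
Qed.

Lemma sublevel_prob_nd (R : realType) (d : nat) (L : 'rV[R]_d -> R)
    (P : probability 'rV[R]_d R) : continuous L ->
  {homo sublevel_prob L P : x y / x <= y}.
Proof.
move=> cL x y xy; rewrite -lee_fin !EFin_sublevel_prob//.
apply: le_measure; rewrite ?inE; try exact: measurable_sublevel.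
by move=> t /= /le_trans; exact.
Qed.

Lemma measurable_sublevel_prob (R : realType) (d : nat) (L : 'rV[R]_d -> R)
    (P : probability 'rV[R]_d R) : continuous L ->
  measurable_fun setT (sublevel_prob L P).
Proof.
move=> cL; apply: nondecreasing_measurable => //.
exact: sublevel_prob_nd.
Qed.

Lemma quantile_nd (R : realType) (d : nat) (L : 'rV[R]_d -> R)
    (P : probability 'rV[R]_d R) (a b : R) : a <= b ->
  (quantile L P a <= quantile L P b)%E.
Proof.
move=> ab; apply: ereal_inf_le_tmp => _ [q /= bq <-]; exists q => //=.
by apply: le_trans bq; rewrite lee_fin.
Qed.

(** A nondecreasing function has intervals as superlevel sets. *)
Lemma measurable_quantile (R : realType) (d : nat) (L : 'rV[R]_d -> R)
    (P : probability 'rV[R]_d R) (D : set R) : measurable D ->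
  measurable_fun D (quantile L P).
Proof.
move=> mD; apply: (measurability _ (ErealGenOInfty.measurableE R)).
move=> _ [_ [x ->] <-]; apply: measurableI => //.
apply: is_interval_measurable => a b /=; rewrite !in_itv/= !andbT => xa _ c.
move=> /andP[ac _]; rewrite in_itv/= andbT.
by apply: lt_le_trans xa _; exact: quantile_nd.
Qed.

Lemma quantile_ge0 (R : realType) (d : nat) (L : 'rV[R]_d -> R)
    (P : probability 'rV[R]_d R) (a : R) :
  (forall t, 0 <= L t) -> 0 < a -> (0 <= quantile L P a)%E.
Proof.
move=> L0 a0; apply: le_ereal_inf_tmp => _ [q /= aq <-]; rewrite lee_fin leNgt.
apply/negP => q0; move: aq; rewrite (_ : mkset _ = set0).
  by rewrite measure0 lee_fin leNgt a0.
by apply/seteqP; split=> // t /=; rewrite leNgt (lt_le_trans q0).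
Qed.

(** For [x] between the two quantiles, the distribution function of [P'] has
    already reached level [a] and that of [P] has not; so the distance of the
    quantiles is at most the length of the set of such [x]. The first inequality
    in that set is weakened from a strict one so that [integral_between]
    applies. *)
Lemma quantile_le_gap (R : realType) (d : nat) (L : 'rV[R]_d -> R)
    (P P' : probability 'rV[R]_d R) (a : R) : continuous L ->
  (-oo < quantile L P' a)%E ->
  (quantile L P a <= quantile L P' a +
   @lebesgue_measure R
     [set x | (sublevel_prob L P x <= a <= sublevel_prob L P' x)%R])%E.
Proof.
move=> cL q'Ny; set H := mkset _; set h := lebesgue_measure H.
have mH : measurable H.
  rewrite (_ : H = sublevel_prob L P @^-1` `]-oo, a] `&`
                   sublevel_prob L P' @^-1` `[a, +oo[).
    by apply: measurableI; rewrite -[X in measurable X]setTI;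
      apply: measurable_sublevel_prob.
  by apply/seteqP; split=> x /=; rewrite !in_itv/= andbT => /andP.
have : (0 <= h)%E by exact: measure_ge0.
case hE : h => [r| |] // r0; last by rewrite addey ?leey// gt_eqF.
rewrite -leeBlDr//; apply: le_ereal_inf_tmp => _ [y /= ay <-].
rewrite EFinN leeBlDr// leNgt; apply/negP => yq.
(* Otherwise the set would contain the interval [y, z], longer than [r]. *)
have [z [yz zq]] : exists z : R, y + r < z /\ (z%:E < quantile L P a)%E.
  case: (quantile L P a) yq => [q|_|//].
    rewrite -EFinD lte_fin => yq; exists ((y + r + q) / 2).
    by rewrite lte_fin; split; lra.
  by exists (y + r + 1); rewrite ltrDl ltr01 ltry.
have : (h < (z - y)%:E)%E by rewrite hE lte_fin ltrBrDl.
rewrite ltNge => /negP; apply.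
have -> : (z - y)%:E = @lebesgue_measure R `[y, z]%classic.
  rewrite lebesgue_measure_itv/= lte_fin.
  case: ltP => [_|]; first by rewrite EFinB.
  by move=> zy; exfalso; move: r0; rewrite lee_fin; lra.
apply: le_measure; rewrite ?inE//.
move=> x /=; rewrite in_itv/= => /andP[yx xz]; apply/andP; split.
  rewrite leNgt; apply/negP => ax; move: zq; rewrite ltNge => /negP; apply.
  apply: (@le_trans _ _ x%:E); last by rewrite lee_fin.
  apply: ereal_inf_lbound; exists x => //=.
  by rewrite -EFin_sublevel_prob// lee_fin ltW.
rewrite -lee_fin; apply: (le_trans ay).
by rewrite -EFin_sublevel_prob// lee_fin; exact: sublevel_prob_nd.
Qed.

(** Integrate [quantile_le_gap] over the levels and slice the region between the
    two distribution functions in the other direction. *)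
Lemma integral_quantile_le (R : realType) (d : nat) (L : 'rV[R]_d -> R)
    (P P' : probability 'rV[R]_d R) (b1 b2 : R) :
  continuous L -> (forall t, 0 <= L t) -> 0 < b1 ->
  (\int[@lebesgue_measure R]_(a in `[b1, b2]) quantile L P a <=
   \int[@lebesgue_measure R]_(a in `[b1, b2]) quantile L P' a +
   \int[@lebesgue_measure R]_x
     (Num.max (sublevel_prob L P' x - sublevel_prob L P x) 0)%R%:E)%E.
Proof.
move=> cL L0 b10.
have mF := measurable_sublevel_prob P cL.
have mF' := measurable_sublevel_prob P' cL.
rewrite -(integral_between (@lebesgue_measure R) mF mF').
have mgap := measurable_fun_between (@lebesgue_measure R) mF mF'.
have b1a a : `[b1, b2]%classic a -> 0 < a.
  by rewrite /= in_itv/= => /andP[b1a _]; exact: lt_le_trans b1a.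
have q0 (P0 : probability 'rV[R]_d R) a : `[b1, b2]%classic a ->
  (0 <= quantile L P0 a)%E by move=> /b1a; exact: quantile_ge0.
have gap_le : (\int[@lebesgue_measure R]_(a in `[b1, b2])
    @lebesgue_measure R
      [set x | (sublevel_prob L P x <= a <= sublevel_prob L P' x)%R] <=
  \int[@lebesgue_measure R]_a @lebesgue_measure R
      [set x | (sublevel_prob L P x <= a <= sublevel_prob L P' x)%R])%E.
  exact: ge0_subset_integral.
apply: le_trans (leeD2l _ gap_le).
rewrite -ge0_integralD//; last 3 first.
- exact: q0.
- exact: measurable_quantile.
- exact: measurable_funTS.
apply: ge0_le_integral => //.
- exact: q0.
- exact: measurable_quantile.
- apply: emeasurable_funD; first exact: measurable_quantile.
  exact: measurable_funTS.
- move=> a ab; apply: quantile_le_gap => //.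
  by apply: lt_le_trans (q0 _ _ ab); rewrite ltNye.
Qed.

(** If [L X' <= x], then either [L X <= x] or [x] lies between [L X'] and [L X];
    integrating the measure of the second event over [x] gives the mean of the
    positive part of [L X - L X']. The maps [X] and [X'] are the two
    projections, in either order, so that the same lemma yields both one-sided
    bounds. *)
Lemma integral_sublevel_prob_le d0 (T : measurableType d0) (R : realType)
    (d : nat) (L : 'rV[R]_d -> R) (P P' : probability 'rV[R]_d R)
    (m : probability T R) (X X' : T -> 'rV[R]_d) :
  continuous L -> measurable_fun setT X -> measurable_fun setT X' ->
  (forall A, measurable A -> P A = m (X @^-1` A)) ->
  (forall A, measurable A -> P' A = m (X' @^-1` A)) ->
  (\int[@lebesgue_measure R]_x
     (Num.max (sublevel_prob L P' x - sublevel_prob L P x) 0)%R%:E <=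
   \int[m]_z (Num.max (L (X z) - L (X' z)) 0)%R%:E)%E.
Proof.
move=> cL mX mX' PX PX'.
have mL := continuous_measurable_rV cL.
have mLX : measurable_fun setT (L \o X) by exact: measurableT_comp.
have mLX' : measurable_fun setT (L \o X') by exact: measurableT_comp.
rewrite -(integral_between m mLX' mLX).
have mF := measurable_sublevel_prob P cL.
have mF' := measurable_sublevel_prob P' cL.
apply: ge0_le_integral => //.
- by move=> x _; rewrite lee_fin le_max lexx orbT.
- apply/measurable_EFinP; apply: measurable_maxr => //.
  exact: measurable_funB.
- exact: measurable_fun_between.
move=> x _; rewrite EFin_max ge_max measure_ge0 andbT.
rewrite EFinB leeBlDr// !EFin_sublevel_prob//.
have mS := measurable_sublevel x cL.
rewrite PX// PX'//.
have mB : measurable [set t | (L \o X') t <= x <= (L \o X) t].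
  rewrite (_ : mkset _ =
      (L \o X') @^-1` `]-oo, x] `&` (L \o X) @^-1` `[x, +oo[).
    by apply: measurableI; rewrite -[X in measurable X]setTI;
      [exact: mLX'|exact: mLX].
  by apply/seteqP; split=> t /=; rewrite !in_itv/= andbT => /andP.
have mXS : measurable (X @^-1` [set t | L t <= x]).
  by rewrite -[X in measurable X]setTI; exact: mX.
have mX'S : measurable (X' @^-1` [set t | L t <= x]).
  by rewrite -[X in measurable X]setTI; exact: mX'.
apply: le_trans (measureU2 m mB mXS).
apply: le_measure; rewrite ?inE//; first exact: measurableU.
move=> z /= X'x; have [Xx|Xx] := leP (L (X z)) x; first by right.
by left; rewrite X'x ltW.
Qed.

(** Cauchy-Schwarz against the constant function 1, of norm 1 under a
    probability. *)
Lemma integral_enorm_le_cost d0 (T : measurableType d0) (R : realType)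
    (d : nat) (m : probability T R) (f : T -> 'rV[R]_d) :
  measurable_fun setT f ->
  (\int[m]_z (enorm (f z))%:E <= (\int[m]_z (enorm (f z) ^+ 2)%:E) `^ 2^-1)%E.
Proof.
move=> mf.
have half : 2^-1 + 2^-1 = 1 :> R by lra.
have := @hoelder _ _ _ m (fun z => enorm (f z)) (cst 1) 2 2
  (measurable_enorm mf) (measurable_cst _) (ltr0Sn _ 1) (ltr0Sn _ 1) half.
have N1 : Lnorm m 2%:E (EFin \o cst 1) = 1%E.
  rewrite [LHS]Lnorm_cst1 -[RHS](poweR1r 2^-1); congr (_ `^ _)%E.
  exact: probability_setT.
rewrite N1 mule1 Lnorm1 unlock /=.
have E1 : (\int[m]_x `|(enorm (f x) * 1)%:E| = \int[m]_z (enorm (f z))%:E)%E.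
  by apply: eq_integral => z _; rewrite mulr1/= ger0_norm ?enorm_ge0.
have E2 : (\int[m]_x (`|enorm (f x)| `^ 2)%:E =
    \int[m]_z (enorm (f z) ^+ 2)%:E)%E.
  apply: eq_integral => z _.
  by rewrite ger0_norm ?enorm_ge0// powR_mulrn ?enorm_ge0.
by rewrite E1 E2.
Qed.

Lemma le_wasserstein2 (R : realType) (d : nat) (P P' : probability 'rV[R]_d R)
    (C1 : R) (J : \bar R) : 0 < C1 -> (0 <= J)%E ->
  (forall g, coupling P P' g ->
     (J <= C1%:E * \int[g]_z (enorm (z.1 - z.2))%:E)%E) ->
  (J <= C1%:E * wasserstein2 P P')%E.
Proof.
move=> C0 J0 HJ; rewrite -lee_pdivrMl//.
(* Passing to squares moves the bound inside the infimum over couplings. *)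
set J' := (_ * J)%E.
have J'0 : (0 <= J')%E by rewrite mule_ge0// lee_fin invr_ge0 ltW.
have -> : J' = ((J' `^ 2) `^ 2^-1)%E.
  by rewrite -poweRrM mulfV// poweRe1.
have inI (x : \bar R) : (0 <= x)%E -> x \in `[0%E, +oo%E].
  by move=> x0; rewrite in_itv/= x0 leey.
apply: gt0_ler_poweR; rewrite ?invr_ge0//.
- exact/inI/poweR_ge0.
- apply/inI/le_ereal_inf_tmp => _ [g _ <-].
  by apply: integral_ge0 => z _; rewrite lee_fin sqr_ge0.
apply: le_ereal_inf_tmp => _ [g gP <-].
have cost0 : (0 <= \int[g]_z (enorm (z.1 - z.2)%R ^+ 2)%:E)%E.
  by apply: integral_ge0 => z _; rewrite lee_fin sqr_ge0.
have -> : (\int[g]_z (enorm (z.1 - z.2)%R ^+ 2)%:E =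
    ((\int[g]_z (enorm (z.1 - z.2)%R ^+ 2)%:E) `^ 2^-1) `^ 2)%E.
  by rewrite -poweRrM mulVf// poweRe1.
apply: gt0_ler_poweR; [by []|exact: inI|exact/inI/poweR_ge0|].
rewrite /J' lee_pdivrMl//; apply: le_trans (HJ _ gP) _.
apply: lee_wpmul2l; first by rewrite lee_fin ltW.
apply: integral_enorm_le_cost.
exact: measurable_pair_sub.
Qed.

(** * Stability of the quantile sets *)

(** Stated as two one-sided inequalities in the extended reals, where the
    thresholds may both be infinite and have no meaningful difference. *)
Lemma threshold_le (R : realType) (d : nat) (L : 'rV[R]_d -> R)
    (beta dq C1 : R) (P P' : probability 'rV[R]_d R) :
  continuous L -> (forall t, 0 <= L t) -> 0 < beta -> 0 < C1 ->
  (forall t t', `|L t - L t'| <= C1 * enorm (t - t')) ->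
  (threshold L beta dq P <=
     threshold L beta dq P' + (2 / beta * C1)%:E * wasserstein2 P P')%E /\
  (threshold L beta dq P' <=
     threshold L beta dq P + (2 / beta * C1)%:E * wasserstein2 P P')%E.
Proof.
move=> cL L0 b0 C0 LC.
have b20 : 0 < beta / 2 by lra.
have tb0 : (0 <= (2 / beta)%:E :> \bar R)%E by rewrite lee_fin divr_ge0// ltW.
pose J (P1 P2 : probability 'rV[R]_d R) := (\int[@lebesgue_measure R]_x
  (Num.max (sublevel_prob L P2 x - sublevel_prob L P1 x) 0)%R%:E)%E.
have J0 P1 P2 : (0 <= J P1 P2)%E.
  by apply: integral_ge0 => x _; rewrite lee_fin le_max lexx orbT.
have step P1 P2 : (J P1 P2 <= C1%:E * wasserstein2 P P')%E ->
    (threshold L beta dq P1 <=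
     threshold L beta dq P2 + (2 / beta * C1)%:E * wasserstein2 P P')%E.
  move=> JW; rewrite /threshold addeAC leeD2r// (EFinM (2 / beta)) -muleA.
  rewrite -ge0_muleDr//; last 2 first.
  - apply: integral_ge0 => a /=; rewrite in_itv/= => /andP[ba _].
    by apply: quantile_ge0 => //; exact: lt_le_trans ba.
  - by rewrite mule_ge0 ?poweR_ge0// lee_fin ltW.
  apply: lee_wpmul2l => //.
  by apply: le_trans (integral_quantile_le P1 P2 _ cL L0 b20) _; exact: leeD2l.
have mcost : measurable_fun setT
    (fun z : 'rV[R]_d * 'rV[R]_d => enorm (z.1 - z.2)).
  by apply: measurable_enorm; exact: measurable_pair_sub.
have mL := continuous_measurable_rV cL.
have JC (g : probability ('rV[R]_d * 'rV[R]_d)%type R)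
    (X X' : 'rV[R]_d * 'rV[R]_d -> 'rV[R]_d) :
    measurable_fun setT X -> measurable_fun setT X' ->
    (forall z, `|L (X z) - L (X' z)| <= C1 * enorm (z.1 - z.2)) ->
    (\int[g]_z (Num.max (L (X z) - L (X' z)) 0)%R%:E <=
     C1%:E * \int[g]_z (enorm (z.1 - z.2))%:E)%E.
  move=> mX mX' XC; rewrite -ge0_integralZl_EFin//; last 3 first.
  - by move=> z _; rewrite lee_fin enorm_ge0.
  - exact/measurable_EFinP.
  - exact: ltW.
  apply: ge0_le_integral => //.
  - by move=> z _; rewrite lee_fin le_max lexx orbT.
  - apply/measurable_EFinP; apply: measurable_maxr => //.
    by apply: measurable_funB; exact: measurableT_comp.
  - by apply/measurable_EFinP; exact: measurable_funM.
  - move=> z _; rewrite -EFinM lee_fin ge_max.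
    by rewrite (le_trans (ler_norm _) (XC z)) mulr_ge0 ?enorm_ge0// ltW.
split; apply: step; apply: le_wasserstein2 => // g gP.
- apply: le_trans (JC g fst snd _ _ (fun z => LC z.1 z.2)) => //.
  apply: integral_sublevel_prob_le => //.
  + move=> A mA; have [<- _] := gP _ mA; congr (g _).
    by apply/seteqP; split=> z //= [].
  + move=> A mA; have [_ <-] := gP _ mA; congr (g _).
    by apply/seteqP; split=> z //= [].
- apply: le_trans (JC g snd fst _ _ _) => //; last first.
    by move=> z; rewrite distrC; exact: LC.
  apply: integral_sublevel_prob_le => //.
  + move=> A mA; have [_ <-] := gP _ mA; congr (g _).
    by apply/seteqP; split=> z //= [].
  + move=> A mA; have [<- _] := gP _ mA; congr (g _).
    by apply/seteqP; split=> z //= [].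
Qed.

Lemma threshold_ge0 (R : realType) (d : nat) (L : 'rV[R]_d -> R)
    (beta dq : R) (P : probability 'rV[R]_d R) :
  (forall t, 0 <= L t) -> 0 < beta -> 0 <= dq ->
  (0 <= threshold L beta dq P)%E.
Proof.
move=> L0 b0 dq0; rewrite /threshold adde_ge0 ?lee_fin//.
rewrite mule_ge0 ?lee_fin ?divr_ge0 ?(ltW b0)//.
apply: integral_ge0 => a /=; rewrite in_itv/= => /andP[ba _].
by apply: quantile_ge0 => //; apply: lt_le_trans ba; lra.
Qed.

(** If [s'] is infinite, or at least [s], the difference is empty; otherwise its
    volume is an increment of the volume function. *)
Lemma leb_shell_le (R : realType) (d : nat) (L : 'rV[R]_d -> R)
    (r CL e : R) (s s' : \bar R) :
  continuous L ->
  CL.-lipschitz_[set q : R | 0 <= q] (volume_sublevel L r) ->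
  (0 <= s)%E -> (0 <= s')%E -> 0 <= e -> (s <= s' + e%:E)%E ->
  (leb R d ((@eball R d r `&` [set t | ((L t)%:E <= s)%E]) `\`
            (@eball R d r `&` [set t | ((L t)%:E <= s')%E])) <=
   (`|CL| * e)%:E)%E.
Proof.
move=> cL Lip s0 s'0 e0.
have CLe : (0 <= (`|CL| * e)%:E :> \bar R)%E by rewrite lee_fin mulr_ge0.
have [ss' _|s's] := leP s s'.
  rewrite (_ : _ `\` _ = set0) ?measure0//.
  apply/seteqP; split=> // t [[tr Ls]]; apply; split=> //=.
  exact: le_trans ss'.
case: s' s'0 s's => [q'| |] //; last by move=> _; rewrite ltNge leey.
case: s s0 => [q| |] // q0 q'0 q'q qe.
set A := _ `&` _; set A' := _ `&` _.
have mA : measurable A by exact: measurable_cap_eball_sublevel.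
have mA' : measurable A' by exact: measurable_cap_eball_sublevel.
have fin B : measurable B -> B `<=` eball r -> (leb R d B < +oo)%E.
  move=> mB Br; apply: le_lt_trans (leb_eball_lty d r).
  by apply: le_measure; rewrite ?inE//; exact: measurable_eball.
have A'A : A' `<=` A.
  by move=> t [tr /= Lt]; split=> //=; apply: le_trans Lt (ltW q'q).
rewrite measureD//; last by apply: fin => // t [].
rewrite (setIidr A'A).
rewrite -[X in (X - _)%E]fineK ?ge0_fin_numE//; last by apply: fin => // t [].
rewrite -[X in (_ - X)%E]fineK ?ge0_fin_numE//; last by apply: fin => // t [].
rewrite -EFinB lee_fin.
have /= := Lip (q, q') (conj q0 q'0).
rewrite lee_fin in q0; rewrite lee_fin in q'0.
move=> h; apply: (le_trans (ler_norm _)); apply: (le_trans h).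
move: q'q qe; rewrite -EFinD lte_fin lee_fin => q'q qe.
apply: (@le_trans _ _ (`|CL| * `|q - q'|)).
  by rewrite ler_wpM2r// ler_norm.
by rewrite ler_wpM2l// ger0_norm; lra.
Qed.

(** * Measures with a density on the ball *)

Lemma density_le_Linf (R : realType) (d : nat) (B : set 'rV[R]_d)
    (P : probability 'rV[R]_d R) (rho : 'rV[R]_d -> R) (N : R)
    (A : set 'rV[R]_d) :
  measurable A -> A `<=` B -> density_on B P rho -> Linf_on B rho = N%:E ->
  (P A <= N%:E * leb R d A)%E.
Proof.
move=> mA AB [mrho rho0 PE] LN; rewrite PE//.
have N0 : (0 <= N%:E)%E by rewrite -LN Lnorm_ge0.
have mr : measurable_fun A (EFin \o rho).
  by apply: measurable_funTS; exact/measurable_EFinP.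
move: LN; rewrite /Linf_on unlock; case: ifPn => [leb0|]; last first.
  (* For a null Lebesgue measure the essential supremum is 0 by convention. *)
  rewrite -leNgt => leb0 _.
  have A0 : leb R d A = 0%E.
    apply/eqP; rewrite -measure_le0; apply: le_trans leb0.
    by apply: le_measure; rewrite ?inE.
  by rewrite null_set_integral// mule_ge0.
move=> LN.
have := @ess_sup_ge _ _ R (leb R d) (abse \o (fun t => (\1_B t * rho t)%:E)).
rewrite LN => aeN.
rewrite -integral_cst//; apply: ae_ge0_le_integral => //.
- by move=> t _; rewrite /= lee_fin.
apply: filterS aeN => t /= + At.
rewrite indicE mem_set ?mul1r; last exact: AB.
by rewrite ger0_norm.
Qed.

Lemma L2_onC (R : realType) (d : nat) (B : set 'rV[R]_d) (f g : 'rV[R]_d -> R) :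
  L2_on B (fun t => f t - g t) = L2_on B (fun t => g t - f t).
Proof.
rewrite /L2_on -oppe_Lnorm; apply: eq_Lnorm => t /=.
by rewrite -mulrN opprB.
Qed.

(** Bound [rho] by [rho' + |rho - rho'|] and apply Cauchy-Schwarz to the product
    of [|rho - rho'|] with the indicator of [B]. *)
Lemma density_le_L2 (R : realType) (d : nat) (B : set 'rV[R]_d)
    (P P' : probability 'rV[R]_d R) (rho rho' : 'rV[R]_d -> R)
    (A : set 'rV[R]_d) :
  measurable B -> measurable A -> A `<=` B ->
  density_on B P rho -> density_on B P' rho' ->
  (P A <= P' A + leb R d B `^ 2^-1 * L2_on B (fun t => (rho t - rho' t)%R))%E.
Proof.
move=> mB mA AB [mrho rho0 PE] [mrho' rho0' PE'].
have mD : measurable_fun setT (fun t => rho t - rho' t).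
  exact: measurable_funB.
have mBD : measurable_fun setT (fun t => \1_B t * (rho t - rho' t)).
  by apply: measurable_funM.
have half : 2^-1 + 2^-1 = 1 :> R by lra.
have hol := @hoelder _ _ _ (leb R d) (fun t => \1_B t)
  (fun t => \1_B t * (rho t - rho' t)) 2 2
  (measurable_indic mB) mBD (ltr0Sn _ 1) (ltr0Sn _ 1) half.
have N1 : Lnorm (leb R d) 2%:E (fun t => (\1_B t)%:E) = (leb R d B `^ 2^-1)%E.
  rewrite unlock; congr (_ `^ _)%E.
  rewrite -[in RHS](setIT B) -integral_indic//; apply: eq_integral => t _ /=.
  by rewrite indicE; case: (t \in B); rewrite ?normr1 ?normr0 ?powR1 ?powR0.
move: hol; rewrite N1 => /(leeD2l (P' A)); apply: le_trans.
rewrite Lnorm1 PE// PE'//.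
have mabs : measurable_fun A (fun t => `|rho t - rho' t|%:E).
  by apply: measurable_funTS; apply/measurable_EFinP; exact: measurableT_comp.
have mEr : measurable_fun A (EFin \o rho).
  by apply: measurable_funTS; exact/measurable_EFinP.
have mEr' : measurable_fun A (EFin \o rho').
  by apply: measurable_funTS; exact/measurable_EFinP.
apply: (@le_trans _ _
    (\int[leb R d]_(t in A) ((rho' t)%:E + `|rho t - rho' t|%:E))%E).
  apply: ge0_le_integral => //.
  - by move=> t _; rewrite lee_fin.
  - exact: emeasurable_funD.
  - move=> t _; rewrite -EFinD lee_fin -lerBlDl; exact: ler_norm.
rewrite ge0_integralD//; last by move=> t _; rewrite lee_fin.
apply: leeD2l.
have mbig : measurable_fun setT
    (fun t => `|(\1_B t * (\1_B t * (rho t - rho' t)))%:E|%E).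
  apply: measurableT_comp => //; apply/measurable_EFinP.
  by apply: measurable_funM.
apply: (@le_trans _ _ (\int[leb R d]_(t in A)
    `|(\1_B t * (\1_B t * (rho t - rho' t)))%:E|)%E).
  rewrite le_eqVlt; apply/orP; left; apply/eqP.
  apply: eq_integral => t /set_mem/AB tB.
  by rewrite indicE mem_set//= !mul1r.
exact: ge0_subset_integral.
Qed.

(** * The stability estimate and the consensus point *)

(** The summand 1 keeps the constant positive, so that the right-hand side is
    infinite as soon as one of the two distances is. *)
Lemma quantile_estimate_of_lipschitz (R : realType) (d : nat)
    (L : 'rV[R]_d -> R) (beta dq r M N CL C1 : R) :
  continuous L -> (forall t, 0 <= L t) -> 0 < beta -> 0 <= dq -> 0 < r ->
  0 < C1 -> (forall t t', `|L t - L t'| <= C1 * enorm (t - t')) ->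
  CL.-lipschitz_[set q : R | 0 <= q] (volume_sublevel L r) ->
  quantile_estimate L beta dq r M N
    (1 + 3 * `|M| * (fine (leb R d (@eball R d r) `^ 2^-1)%E +
                     `|N| * (`|CL| * (2 / beta * C1)))).
Proof.
move=> cL L0 b0 dq0 r0 C10 LC Lip P P' rho rho' _ _ Prho P'rho' _ LN k f mf fM.
set V := fine _.
have V0 : 0 <= V by rewrite fine_ge0// poweR_ge0.
set E := `|CL| * (2 / beta * C1).
have C0 : 0 <= 2 / beta * C1 by rewrite mulr_ge0 ?divr_ge0// ltW.
have E0 : 0 <= E by rewrite mulr_ge0.
set Ct := (X in (_ <= X%:E * _)%E).
have Ct0 : 0 < Ct.
  rewrite /Ct ltr_pwDl// mulr_ge0 ?mulr_ge0// addr_ge0// mulr_ge0//.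
set l := L2_on _ _; set w := wasserstein2 P P'.
have l0 : (0 <= l)%E by exact: Lnorm_ge0.
have w0 : (0 <= w)%E by exact: poweR_ge0.
have [lth thl] := threshold_le dq P P' cL L0 b0 C10 LC.
rewrite -/w in lth thl.
have mQ := measurable_Qset beta dq r P cL.
have mQ' := measurable_Qset beta dq r P' cL.
have mB := @measurable_eball R d r.
have VE : (leb R d (@eball R d r) `^ 2^-1)%E = V%:E.
  by rewrite fineK// fin_num_poweR// ge0_fin_numE//; exact: leb_eball_lty.
have PP' A : measurable A -> A `<=` eball r -> (P A <= P' A + V%:E * l)%E.
  by move=> mA AB; rewrite -VE; exact: density_le_L2 mB mA AB Prho P'rho'.
have P'P A : measurable A -> A `<=` eball r -> (P' A <= P A + V%:E * l)%E.
  move=> mA AB; rewrite -VE /l L2_onC.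
  exact: density_le_L2 mB mA AB P'rho' Prho.
case: l l0 PP' P'P => [l| |] // l0 PP' P'P; last first.
  by rewrite addye ?gt_eqF ?(lt_le_trans _ w0)// gt0_muley ?leey// lte_fin.
case: w w0 lth thl => [w| |] // w0 lth thl; last first.
  by rewrite addey// gt0_muley ?leey// lte_fin.
rewrite !lee_fin in l0 w0.
have {}lth : (threshold L beta dq P <=
    threshold L beta dq P' + (2 / beta * C1 * w)%:E)%E by exact: lth.
have {}thl : (threshold L beta dq P' <=
    threshold L beta dq P + (2 / beta * C1 * w)%:E)%E by exact: thl.
have e0 : 0 <= 2 / beta * C1 * w by rewrite mulr_ge0.
have th0 P0 : (0 <= threshold L beta dq P0)%E by exact: threshold_ge0.
have shell := leb_shell_le cL Lip (th0 P) (th0 P') e0 lth.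
have shell' := leb_shell_le cL Lip (th0 P') (th0 P) e0 thl.
have N0 : 0 <= N by rewrite -lee_fin -LN Lnorm_ge0.
set Q := Qset _ _ _ _ P; set Q' := Qset _ _ _ _ P'.
have QB : Q `<=` eball r by move=> t [].
have Q'B : Q' `<=` eball r by move=> t [].
have shellP S S' : measurable S -> measurable S' -> S `<=` eball r ->
    (leb R d (S `\` S') <= (`|CL| * (2 / beta * C1 * w))%:E)%E ->
    (P' (S `\` S') <= (N * E * w)%:E)%E.
  move=> mS mS' SB SS'.
  apply: le_trans (density_le_Linf _ _ P'rho' LN) _.
  - exact: measurableD.
  - by move=> t [/SB].
  - apply: le_trans (lee_wpmul2l _ SS') _; rewrite ?lee_fin//.
    by rewrite /E; lra.
have sQQ' := shellP _ _ mQ mQ' QB shell.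
have sQ'Q := shellP _ _ mQ' mQ Q'B shell'.
(* The cost of replacing [S] by [S']. *)
have capD (m : probability 'rV[R]_d R) A S S' : measurable A -> measurable S ->
    measurable S' -> (m (A `&` S) <= m (A `&` S') + m (S `\` S'))%E.
  move=> mA mS mS'.
  have m1 : measurable (A `&` S') by exact: measurableI.
  have m2 : measurable (S `\` S') by exact: measurableD.
  apply: le_trans (measureU2 m m1 m2); apply: le_measure; rewrite ?inE.
  - exact: measurableI.
  - exact: measurableU.
  - by move=> t [At St]; have [S't|S't] := pselect (S' t); [left|right].
pose D := V * l + N * E * w.
have D0 : 0 <= D.
  by apply: addr_ge0; rewrite mulr_ge0// mulr_ge0.
have M0 : 0 <= M.
  apply: le_trans (fM 0 _); first exact: enorm_ge0.
  by rewrite /eball/= /enorm big1 ?sqrtr0 ?ltW// => i _; rewrite mxE expr0n.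
have ev A : measurable A -> (P (A `&` Q) <= P' (A `&` Q') + D%:E)%E.
  move=> mA; apply: le_trans (PP' _ _ _) _.
  - exact: measurableI.
  - by move=> t [_ /QB].
  rewrite (_ : D = N * E * w + V * l) ?EFinD ?addeA; last by rewrite addrC.
  apply: leeD => //.
  by apply: le_trans (capD P' A Q Q' mA mQ mQ') _; exact: leeD2l.
have ev' A : measurable A -> (P' (A `&` Q') <= P (A `&` Q) + D%:E)%E.
  move=> mA; apply: le_trans (capD P' A Q' Q mA mQ' mQ) _.
  rewrite /D EFinD addeA; apply: leeD => //.
  by apply: P'P; [exact: measurableI|by move=> t [_ /QB]].
suff : enorm (vintegral P Q f - vintegral P' Q' f) <= Ct * (l + w) by [].
have fQ t : Q t -> enorm (f t) <= M by move=> /QB/fM.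
have fQ' t : Q' t -> enorm (f t) <= M by move=> /Q'B/fM.
apply: le_trans
  (enorm_vintegral_dist_le_events mQ mQ' mf D0 M0 ev ev' fQ fQ') _.
rewrite /Ct /D (ger0_norm M0) (ger0_norm N0).
have h1 : 0 <= M * (V * w) by rewrite !mulr_ge0.
have h2 : 0 <= M * (N * E * l) by rewrite mulr_ge0// mulr_ge0// mulr_ge0.
nra.
Qed.

Unset Implicit Arguments.

Theorem proposition3p2 (R : realType) :
  exists C : R -> R -> R -> R -> R,
  forall (d : nat) (L : 'rV[R]_d -> R) (beta : R),
    0 < beta <= 1 ->
    continuous L ->
    (* (W1) *) has_lbound (range L) ->
    (* (W2) *)
    (exists C1 : R, 0 < C1 /\
       forall t t', `|L t - L t'| <= C1 * enorm (t - t')) ->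
  (* existence of the constant Ct of the stability estimate *)
  (0 <= inf (range L) ->
   exists Ct : R -> R -> R -> R -> R,
   forall dq r M N CL : R, 0 < dq -> 0 < r ->
     CL.-lipschitz_[set q : R | 0 <= q] (volume_sublevel L r) ->
     quantile_estimate L beta dq r M N (Ct r M N CL))
  /\
  (forall (G : 'rV[R]_d -> R) (alpha dq r CL C4 K c M N Ct : R)
     (P P' : probability 'rV[R]_d R) (rho rho' : 'rV[R]_d -> R),
     0 < alpha -> 0 < dq -> 0 < r ->
     continuous G ->
     (* (W3) *)
     CL.-lipschitz_[set q : R | 0 <= q] (volume_sublevel L r) ->
     (* (W4) *) has_lbound (range G) ->
     (* (W5) *)
     (has_ubound (range G) \/
        exists C2 C3 : R, [/\ 0 < C2, 0 < C3 &
          forall t, C3 <= enorm t ->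
            C2 * enorm t ^+ 2 <= G t - inf (range G)]) ->
     (* (W6) *) 0 < C4 ->
     (forall t, G t - inf (range G) <= C4 * (1 + enorm t ^+ 2)) ->
     (second_moment P <= K%:E)%E -> (second_moment P' <= K%:E)%E ->
     density_on (eball r) P rho -> density_on (eball r) P' rho' ->
     (Linf_on (eball r) rho < +oo)%E -> Linf_on (eball r) rho' = N%:E ->
     0 < c ->
     (c%:E <= P (Qset L beta dq r P))%E ->
     (c%:E <= P' (Qset L beta dq r P'))%E ->
     1 <= M -> r <= M ->
     quantile_estimate L beta dq r M N Ct ->
     ((enorm (consensus_point G L alpha beta dq r P -
              consensus_point G L alpha beta dq r P')%R)%:E
      <= (C r K (c^-1 * expR (alpha / c * C4 * (1 + K))) Ct)%:E
         * (L2_on (eball r) (fun t => (rho t - rho' t)%R)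
            + wasserstein2 P P'))%E).

Proof.
exists (fun r K cK Ct => cK * (1 + r) * Ct).
move=> d L beta /andP[b0 b1] cL Lbd [C1 [C10 LC]]; split.
  move=> infL0.
  have L0 t : 0 <= L t.
    by apply: le_trans infL0 _; apply: ge_inf => //; exists t.
  exists (fun r M N CL => 1 + 3 * `|M| *
    (fine (leb R d (@eball R d r) `^ 2^-1)%E +
     `|N| * (`|CL| * (2 / beta * C1)))).
  move=> dq r M N CL dq0 r0 Lip.
  by apply: quantile_estimate_of_lipschitz => //; exact: ltW.
move=> G alpha dq r CL C4 K c M N Ct P P' rho rho' a0 dq0 r0 cG _ Gl _ C40 G4
  PK P'K Prho P'rho' rhoL rhoN c0 cP cP' M1 rM est.
rewrite EFinM -muleA.
apply: consensus_point_dist => //; first exact: ltW.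
move=> k f mf f1r.
apply: (est P P' rho rho') => //.
- by apply: le_lt_trans PK _; rewrite ltry.
- by apply: le_lt_trans P'K _; rewrite ltry.
- by move=> t /f1r/le_trans; apply; rewrite ge_max M1.
Qed.
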